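(* Let $k$ be an infinite field of characteristic $p>0$. Let $R=k[Y_1,\ldots,Y_d]$ be standard graded ($\deg Y_j=1$ for all $j$). Let $\mathcal{M}$ be a graded $F_R$-finite module. Then for $i=0,\ldots,d$ the Koszul homology modules $H_i(Y_1,\ldots,Y_d;\mathcal{M})$ are concentrated in degree zero, i.e., $H_i(Y_1,\ldots,Y_d;\mathcal{M})_r=0$ for all $r\neq 0$.
   Context: Let $R'$ be the $R$-bimodule which is $R$ as a left $R$-module and has right action $r'\cdot r=r^pr'$. For an $R$-module $M$ set $F(M)=R'\otimes_R M$, an $R$-module via the left structure on $R'$. If $M$ is graded, $F(M)$ is graded by $|r'\otimes m|=|r'|+p|m|$ for homogeneous $r',m$. A graded $F_R$-module is a graded $R$-module $\mathcal{M}$ with a degree-preserving $R$-module isomorphism $\theta\colon\mathcal{M}\to F(\mathcal{M})$. It is graded $F_R$-finite if there are a finitely generated graded $R$-module $M$ and a degree-preserving $R$-linear map $\beta\colon M\to F(M)$ such that $\mathcal{M}$ is (as a graded module) the direct limit of $M\xrightarrow{\beta}F(M)\xrightarrow{F(\beta)}F^2(M)\to\cdots$, with $\theta$ induced by the maps $F^j(\beta)\colon F^j(M)\to F^{j+1}(M)$. The Koszul complex $K_\bullet(Y_1,\ldots,Y_d;\mathcal{M})$ is graded so that its differentials preserve degree: $K_i=\mathcal{M}(-i)^{\binom{d}{i}}$, where $N(a)_n=N_{a+n}$. *)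

(* Defs.v *)
From HB Require Import structures.
From mathcomp Require Import all_boot all_order all_algebra.
From mathcomp Require Import generic_quotient ring_quotient boolp freeg mpoly.

Set Implicit Arguments.
Unset Strict Implicit.
Unset Printing Implicit Defensive.

Import GRing.Theory.
Local Open Scope ring_scope.
Local Open Scope quotient_scope.

(* -------------------------------------------------------------------- *)
(* Quotient of a module by a submodule: ring_quotient only provides the
   zmodType structure. *)
Section QuotientModule.
Variables (R : pzRingType) (V : lmodType R) (S : submodClosed V).

(* submodClosed does not inherit from zmodClosed, even over a ring. *)
Definition modpred : pred V := fun x => x \in S.

Fact modpred_closed : zmod_closed modpred.
Proof.
split; first exact: (rpred0 S).
move=> x y hx hy; change (x - y \in S); rewrite -scaleN1r.
apply: (rpredD (S := S)); first exact: hx.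
by apply: (rpredZ (s := S)); exact: hy.
Qed.

HB.instance Definition _ := GRing.isZmodClosed.Build V modpred modpred_closed.

Definition modzmod : zmodClosed V := GRing.ZmodClosed.clone V modpred _.

Definition modquot : Type := {ideal_quot modzmod}.

HB.instance Definition _ := GRing.Zmodule.on modquot.

Definition modquot_pi (x : V) : modquot := \pi_({ideal_quot modzmod}) x.

Lemma modquot_piB : {morph modquot_pi : x y / x - y}.
Proof. by move=> x y; rewrite /modquot_pi raddfB. Qed.

Lemma modquot_piD : {morph modquot_pi : x y / x + y}.
Proof. by move=> x y; rewrite /modquot_pi raddfD. Qed.

Lemma modquot_pi_eq (x y : V) : (modquot_pi x = modquot_pi y) <-> (x - y \in S).
Proof.
have -> : (x - y \in S) = (x == y %[mod {ideal_quot modzmod}]).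
  exact: (Quotient.idealrBE modzmod x y).
by split=> /eqP.
Qed.

Definition modquot_scale (a : R) (x : modquot) : modquot :=
  modquot_pi (a *: (repr (x : {ideal_quot modzmod}) : V)).

Lemma modquot_reprK (x : modquot) : modquot_pi (repr (x : {ideal_quot modzmod})) = x.
Proof. exact: reprK. Qed.

Lemma modquot_scale_pi a x :
  modquot_scale a (modquot_pi x) = modquot_pi (a *: x).
Proof.
apply/modquot_pi_eq; rewrite -scalerBr rpredZ //.
by apply/modquot_pi_eq; exact: modquot_reprK.
Qed.

Fact modquot_scalerA a b x :
  modquot_scale a (modquot_scale b x) = modquot_scale (a * b) x.
Proof. by rewrite -(modquot_reprK x) !modquot_scale_pi scalerA. Qed.

Fact modquot_scale1r : left_id 1 modquot_scale.
Proof. by move=> x; rewrite -(modquot_reprK x) modquot_scale_pi scale1r. Qed.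

Fact modquot_scalerDr : right_distributive modquot_scale +%R.
Proof.
move=> a x y; rewrite -(modquot_reprK x) -(modquot_reprK y).
by rewrite -modquot_piD !modquot_scale_pi scalerDr modquot_piD.
Qed.

Fact modquot_scalerDl x : {morph modquot_scale^~ x : a b / a + b}.
Proof.
move=> a b; rewrite -(modquot_reprK x) !modquot_scale_pi scalerDl.
by rewrite modquot_piD.
Qed.

HB.instance Definition _ := GRing.Zmodule_isLmodule.Build R modquot
  modquot_scalerA modquot_scale1r modquot_scalerDr modquot_scalerDl.

Fact modquot_pi_is_linear : linear modquot_pi.
Proof. by move=> a x y; rewrite modquot_piD -modquot_scale_pi. Qed.

HB.instance Definition _ :=
  GRing.isLinear.Build R V modquot _ modquot_pi modquot_pi_is_linear.

End QuotientModule.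

(* -------------------------------------------------------------------- *)
(* F(M) = R' (x)_R M: the free abelian group on R' x M modulo the relations
   of the tensor product, R' having right action r' . r = r ^+ p * r'. *)
Section Frobenius.
Variables (R : comNzRingType) (p : nat).

Section Object.
Variable M : lmodType R.

Inductive frob_rel : {freeg (R * M)} -> Prop :=
  | FrobRel0 : frob_rel 0
  | FrobRelB x y of frob_rel x & frob_rel y : frob_rel (x - y)
  | FrobRelDl a b m :
      frob_rel (<< (a + b, m) >> - << (a, m) >> - << (b, m) >>)
  | FrobRelDr a m n :
      frob_rel (<< (a, m + n) >> - << (a, m) >> - << (a, n) >>)
  | FrobRelA a r m : frob_rel (<< (r ^+ p * a, m) >> - << (a, r *: m) >>).

Definition frob_relb (x : {freeg (R * M)}) : bool := `[< frob_rel x >].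

Fact frob_relb_closed : zmod_closed frob_relb.
Proof.
split; first by apply/asboolP; exact: FrobRel0.
by move=> x y /asboolP hx /asboolP hy; apply/asboolP; exact: FrobRelB.
Qed.

HB.instance Definition _ :=
  GRing.isZmodClosed.Build {freeg (R * M)} frob_relb frob_relb_closed.

Definition frob_zmod : zmodClosed {freeg (R * M)} :=
  GRing.ZmodClosed.clone {freeg (R * M)} frob_relb _.

Definition frob : Type := {ideal_quot frob_zmod}.

HB.instance Definition _ := GRing.Zmodule.on frob.

Definition frob_pi (x : {freeg (R * M)}) : frob := \pi_({ideal_quot frob_zmod}) x.

Definition frob_tens (a : R) (m : M) : frob := frob_pi << (a, m) >>.

(* The additive map F(M) -> V with a (x) m |-> b a m, for b balanced;
   zmodule V is V seen as a Z-module. *)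
Definition frob_lift (V : zmodType) (b : R -> M -> V) (t : frob) : V :=
  @fglift int (zmodule V) (R * M)%type (fun u => b u.1 u.2) (repr (t : {ideal_quot frob_zmod})).

Definition frob_balanced (V : zmodType) (b : R -> M -> V) : Prop :=
  [/\ forall m, {morph b^~ m : x y / x + y},
      forall a, {morph b a : x y / x + y} &
      forall a r m, b (r ^+ p * a) m = b a (r *: m)].

Lemma frob_piB : {morph frob_pi : x y / x - y}.
Proof. by move=> x y; rewrite /frob_pi raddfB. Qed.

Lemma frob_pi0 : frob_pi 0 = 0.
Proof. by rewrite /frob_pi raddf0. Qed.

Lemma frob_reprK (t : frob) : frob_pi (repr (t : {ideal_quot frob_zmod})) = t.
Proof. exact: reprK. Qed.

Lemma frob_pi_eq x y : (frob_pi x = frob_pi y) <-> frob_rel (x - y).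
Proof.
have E : (x - y \in frob_relb) = (x == y %[mod {ideal_quot frob_zmod}]).
  exact: (Quotient.idealrBE frob_zmod x y).
split=> [h|/asboolP h].
  by apply/asboolP; move: E; rewrite unfold_in => ->; apply/eqP.
by apply/eqP; rewrite -E.
Qed.

Fact frob_subr_eq0 (V : zmodType) (x y z : V) : x = y + z -> x - y - z = 0.
Proof. by move=> ->; rewrite [y + z]addrC addrK subrr. Qed.

Lemma frob_liftE (V : zmodType) (b : R -> M -> V) : frob_balanced b ->
  [/\ {morph frob_lift b : x y / x - y} &
      forall a m, frob_lift b (frob_tens a m) = b a m].
Proof.
case=> bDl bDr bA.
pose g := @fglift int (zmodule V) (R * M)%type (fun u => b u.1 u.2).
have gB : {morph g : x y / x - y} by exact: (@lift_is_additive int).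
have gU a m : g << (a, m) >> = b a m.
  by rewrite /g (@liftU int) scale1r.
have g0 : g 0 = 0 by rewrite -[0 in LHS](subrr 0) gB subrr.
have grel x : frob_rel x -> g x = 0.
  elim=> [|u v _ hu _ hv|c d m|c m n|c r m] //; rewrite !gB.
  - by rewrite hu hv subrr.
  - by apply: frob_subr_eq0; rewrite !gU -bDl.
  - by apply: frob_subr_eq0; rewrite !gU -bDr.
  - by rewrite !gU bA subrr.
have gpi x : frob_lift b (frob_pi x) = g x.
  apply/eqP; rewrite -subr_eq0 -[frob_lift b _]/(g _) -gB; apply/eqP/grel.
  by apply/frob_pi_eq; rewrite frob_reprK.
split=> [x y|a m]; last by rewrite gpi gU.
by rewrite -(frob_reprK x) -(frob_reprK y) -frob_piB !gpi gB.
Qed.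

Lemma frob_ind (P : frob -> Prop) :
  P 0 -> (forall x y, P x -> P y -> P (x - y)) ->
  (forall a m, P (frob_tens a m)) -> forall t, P t.
Proof.
move=> P0 PB PT t; rewrite -(frob_reprK t).
have PN x : P x -> P (- x) by move=> hx; rewrite -sub0r; exact: PB.
have PD x y : P x -> P y -> P (x + y).
  by move=> hx hy; rewrite -[y]opprK; apply: PB => //; exact: PN.
move: (repr _) => D; rewrite -(freeg_sumE D) /frob_pi raddf_sum /=.
elim/big_ind: _ => // -[a m] _; rewrite -[coeff _ _]intz -freegU_mulz raddfMz.
case: (coeff _ _) => n.
  rewrite -pmulrn; elim: n => [|n IH]; first by rewrite mulr0n.
  by rewrite mulrS; apply: PD => //; exact: PT.
rewrite NegzE mulrNz; apply: PN; rewrite -pmulrn.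
by elim: n.+1 => [|j IH]; rewrite ?mulr0n // mulrS; apply: PD => //; exact: PT.
Qed.

Lemma frob_tensDl a b m : frob_tens (a + b) m = frob_tens a m + frob_tens b m.
Proof.
apply/eqP; rewrite -subr_eq0 opprD addrA -!frob_piB; apply/eqP.
by rewrite -frob_pi0; apply/frob_pi_eq; rewrite subr0; exact: FrobRelDl.
Qed.

Lemma frob_tensDr a m n : frob_tens a (m + n) = frob_tens a m + frob_tens a n.
Proof.
apply/eqP; rewrite -subr_eq0 opprD addrA -!frob_piB; apply/eqP.
by rewrite -frob_pi0; apply/frob_pi_eq; rewrite subr0; exact: FrobRelDr.
Qed.

Lemma frob_tensA a r m : frob_tens (r ^+ p * a) m = frob_tens a (r *: m).
Proof. by apply/frob_pi_eq; exact: FrobRelA. Qed.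

Definition frob_scale (c : R) : frob -> frob :=
  frob_lift (fun a m => frob_tens (c * a) m).

Fact frob_scale_balanced c : frob_balanced (fun a m => frob_tens (c * a) m).
Proof.
split=> [m x y|a x y|a r m]; rewrite ?mulrDr ?frob_tensDl ?frob_tensDr //.
by rewrite mulrCA frob_tensA.
Qed.

Lemma frob_scale_tens c a m : frob_scale c (frob_tens a m) = frob_tens (c * a) m.
Proof. by have [_ h] := frob_liftE (frob_scale_balanced c); exact: h. Qed.

Lemma frob_scaleB c : {morph frob_scale c : x y / x - y}.
Proof. by have [] := frob_liftE (frob_scale_balanced c). Qed.

Lemma frob_scale0 c : frob_scale c 0 = 0.
Proof. by rewrite -[0 in LHS](subrr 0) frob_scaleB subrr. Qed.

Fact frob_scalerDr : right_distributive frob_scale +%R.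
Proof.
move=> c x y; rewrite -[y in LHS]opprK frob_scaleB -[- y]sub0r frob_scaleB.
by rewrite frob_scale0 sub0r opprK.
Qed.

Fact frob_scalerA c d x : frob_scale c (frob_scale d x) = frob_scale (c * d) x.
Proof.
elim/frob_ind: x => [|x y hx hy|a m]; rewrite ?frob_scale0 //.
  by rewrite !frob_scaleB hx hy.
by rewrite !frob_scale_tens mulrA.
Qed.

Fact frob_scale1r : left_id 1 frob_scale.
Proof.
elim/frob_ind => [|x y hx hy|a m]; rewrite ?frob_scale0 //.
  by rewrite frob_scaleB hx hy.
by rewrite frob_scale_tens mul1r.
Qed.

Fact frob_scalerDl x : {morph frob_scale^~ x : c d / c + d}.
Proof.
move=> c d; elim/frob_ind: x => [|x y hx hy|a m].
- by rewrite !frob_scale0 addr0.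
- by rewrite !frob_scaleB hx hy opprD addrACA.
- by rewrite !frob_scale_tens mulrDl frob_tensDl.
Qed.

HB.instance Definition _ := GRing.Zmodule_isLmodule.Build R frob
  frob_scalerA frob_scale1r frob_scalerDr frob_scalerDl.

Lemma frob_scaleE c a m : c *: frob_tens a m = frob_tens (c * a) m.
Proof. exact: frob_scale_tens. Qed.

End Object.

Section Map.
Variables (M N : lmodType R) (f : {linear M -> N}).

Definition frob_map : frob M -> frob N :=
  frob_lift (fun a m => frob_tens a (f m)).

Fact frob_map_balanced : frob_balanced (fun a m => frob_tens a (f m)).
Proof.
split=> [m x y|a x y|a r m]; rewrite ?frob_tensDl ?raddfD ?frob_tensDr //.
by rewrite frob_tensA linearZ.
Qed.

Lemma frob_map_tens a m : frob_map (frob_tens a m) = frob_tens a (f m).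
Proof. by have [_ h] := frob_liftE frob_map_balanced; exact: h. Qed.

Fact frob_map_is_linear : linear frob_map.
Proof.
have [mB _] := frob_liftE frob_map_balanced; rewrite -/frob_map in mB.
have m0 : frob_map 0 = 0 by rewrite -[0 in LHS](subrr 0) mB subrr.
have mD x y : frob_map (x + y) = frob_map x + frob_map y.
  by rewrite -[y in LHS]opprK mB -[- y]sub0r mB m0 sub0r opprK.
move=> c x y; rewrite mD; congr (_ + _).
elim/frob_ind: x => [|x z hx hz|a m]; first by rewrite scaler0 m0 scaler0.
  by rewrite scalerBr !mB hx hz scalerBr.
by rewrite frob_scaleE !frob_map_tens frob_scaleE.
Qed.

HB.instance Definition _ :=
  GRing.isLinear.Build R (frob M) (frob N) _ frob_map frob_map_is_linear.

End Map.

Fixpoint frob_iter (j : nat) (M : lmodType R) : lmodType R :=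
  if j is j'.+1 then frob (frob_iter j' M) else M.

Fixpoint frob_iter_map (M : lmodType R) (beta : {linear M -> frob M}) (j : nat) :
    {linear frob_iter j M -> frob (frob_iter j M)} :=
  if j is j'.+1 then frob_map (frob_iter_map beta j') else beta.

End Frobenius.

Arguments frob {R} p M.
Arguments frob_tens {R p M} a m.
Arguments frob_map {R p M N} f.
Arguments frob_iter {R} p j M.
Arguments frob_iter_map {R p M} beta j.

(* -------------------------------------------------------------------- *)
(* A family gr of subsets stands for the homogeneous components:
   gr n x means x \in M_n. *)
Definition grades (M : Type) := int -> M -> Prop.

Definition degree_preserving (M N : Type) (gM : grades M) (gN : grades N)
    (f : M -> N) : Prop :=
  forall n x, gM n x -> gN n (f x).

Section Graded.
Variables (k : fieldType) (d : nat).
Local Notation R := {mpoly k[d]}.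

Record is_grading (M : lmodType R) (gr : grades M) : Prop := IsGrading {
  grading0 : forall n, gr n 0;
  gradingB : forall n x y, gr n x -> gr n y -> gr n (x - y);
  gradingZ : forall (e : nat) n (r : R) x,
    r \is e.-homog -> gr n x -> gr (e%:Z + n) (r *: x);
  grading_span : forall x, exists (s : seq int) (c : int -> M),
    (forall n, gr n (c n)) /\ x = \sum_(n <- s) c n;
  grading_direct : forall (s : seq int) (c : int -> M), uniq s ->
    (forall n, gr n (c n)) -> \sum_(n <- s) c n = 0 ->
    forall n, n \in s -> c n = 0
}.

(* F(M)_n is spanned by the r (x) m with |r| + p |m| = n. *)
Definition frob_grades (p : nat) (M : lmodType R) (gr : grades M) :
    grades (frob p M) :=
  fun n t => exists s : seq (R * M),
    (forall u, u \in s -> exists (e : nat) (b : int),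
       [/\ u.1 \is e.-homog, gr b u.2 & e%:Z + p%:Z * b = n])
    /\ t = \sum_(u <- s) frob_tens u.1 u.2.

Fixpoint frob_iter_grades (p : nat) (M : lmodType R) (gr : grades M) (j : nat) :
    grades (frob_iter p j M) :=
  match j return grades (frob_iter p j M) with
  | 0 => gr
  | j'.+1 => frob_grades (@frob_iter_grades p M gr j')
  end.
Arguments frob_iter_grades {p M} gr j.

Record is_graded_FR_module (p : nat) (M : lmodType R) (gr : grades M)
    (theta : {linear M -> frob p M}) : Prop := IsGradedFRModule {
  FR_grading : is_grading gr;
  FR_bij : bijective theta;
  FR_deg : degree_preserving gr (frob_grades gr) theta
}.

Definition finitely_generated (M : lmodType R) : Prop :=
  exists s : seq M, forall x, exists c : nat -> R,
    x = \sum_(i < size s) c i *: s`_i.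

(* The colimit of M -> F(M) -> F^2(M) -> ... in the category of graded
   R-modules and degree-preserving R-linear maps. *)
Record is_graded_direct_limit (p : nat) (M : lmodType R) (gM : grades M)
    (beta : {linear M -> frob p M}) (L : lmodType R) (gL : grades L)
    (iota : forall j, {linear frob_iter p j M -> L}) : Prop :=
  IsGradedDirectLimit {
  dlim_deg : forall j, degree_preserving (frob_iter_grades gM j) gL (iota j);
  dlim_comp : forall j x, iota j.+1 (frob_iter_map beta j x) = iota j x;
  dlim_univ : forall (N : lmodType R) (gN : grades N)
      (g : forall j, {linear frob_iter p j M -> N}),
    is_grading gN ->
    (forall j, degree_preserving (frob_iter_grades gM j) gN (g j)) ->
    (forall j x, g j.+1 (frob_iter_map beta j x) = g j x) ->
    exists h : {linear L -> N},
      [/\ degree_preserving gL gN h,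
          forall j x, h (iota j x) = g j x &
          forall h' : {linear L -> N}, degree_preserving gL gN h' ->
            (forall j x, h' (iota j x) = g j x) -> h' =1 h]
}.

(* theta is induced by the F^j(beta): its restriction to F^j(M) is
   F(iota_j) o F^j(beta) : F^j(M) -> F^(j+1)(M) -> F(L). *)
Definition is_graded_FR_finite (p : nat) (L : lmodType R) (gL : grades L)
    (theta : {linear L -> frob p L}) : Prop :=
  is_graded_FR_module gL theta /\
  exists (M : lmodType R) (gM : grades M) (beta : {linear M -> frob p M})
    (iota : forall j, {linear frob_iter p j M -> L}),
  [/\ is_grading gM, finitely_generated M,
      degree_preserving gM (frob_grades gM) beta,
      is_graded_direct_limit gM beta gL iota &
      forall j x, theta (iota j x) = frob_map (iota j) (frob_iter_map beta j x)].

End Graded.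

(* -------------------------------------------------------------------- *)
Section Koszul.
Variables (R : comNzRingType) (d : nat) (y : 'I_d -> R) (M : lmodType R).

(* Basis of the i-th exterior power of R^d: the i-subsets of {0, .., d-1}. *)
Definition kidx (i : nat) := {S : {set 'I_d} | #|S| == i}.

Definition koszul (i : nat) : Type := {ffun kidx i -> M}.

HB.instance Definition _ i := GRing.Lmodule.on (koszul i).

(* e_S |-> \sum_(j in S) (-1)^#{l in S | l < j} y_j e_(S \ j), for S of
   cardinal i+1; below this is read off coefficientwise. *)
Definition koszul_diff (i : nat) (x : koszul i.+1) : koszul i :=
  [ffun T : kidx i => \sum_(S : kidx i.+1) \sum_(j in val S | val T == val S :\ j)
     ((-1) ^+ #|[set l in val S | (l < j)%N]| * y j) *: x S].

Fact koszul_diff_is_linear i : linear (@koszul_diff i).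
Proof.
move=> a u v; apply/ffunP=> T; rewrite !ffunE scaler_sumr -big_split /=.
apply: eq_bigr => S _; rewrite scaler_sumr -big_split /=.
by apply: eq_bigr => j _; rewrite !ffunE scalerDr !scalerA [a * _]mulrC.
Qed.

HB.instance Definition _ i := GRing.isLinear.Build R (koszul i.+1) (koszul i) _
  (@koszul_diff i) (@koszul_diff_is_linear i).

Definition koszul_cycle (i : nat) : pred (koszul i) :=
  match i with
  | 0 => fun _ => true
  | i'.+1 => fun x => koszul_diff x == 0
  end.

Fact koszul_cycle_closed i : submod_closed (@koszul_cycle i).
Proof.
case: i => [|i]; first by split.
split; first by rewrite unfold_in /= linear0.
move=> a u v hu hv; apply/eqP; rewrite koszul_diff_is_linear.
have -> : koszul_diff u = 0 by apply/eqP; exact: hu.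
have -> : koszul_diff v = 0 by apply/eqP; exact: hv.
by rewrite scaler0 addr0.
Qed.

Fact koszul_cycle_closedS i : GRing.subsemimod_closed (@koszul_cycle i).
Proof. exact: GRing.submod_closed_semi (@koszul_cycle_closed i). Qed.

HB.instance Definition _ i :=
  GRing.isSubmodClosed.Build R (koszul i) (@koszul_cycle i)
    (@koszul_cycle_closedS i).

Record koszul_cycles (i : nat) := KoszulCycles {
  cycle_val :> koszul i;
  _ : cycle_val \in @koszul_cycle i
}.

HB.instance Definition _ i := [isSub for @cycle_val i].
HB.instance Definition _ i := [Choice of koszul_cycles i by <:].
HB.instance Definition _ i :=
  [SubChoice_isSubLmodule of koszul_cycles i by <:].

Definition koszul_boundary (i : nat) (z : koszul_cycles i) : bool :=
  `[< exists w : koszul i.+1, koszul_diff w = val z >].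

Fact koszul_boundary_closed i : submod_closed (@koszul_boundary i).
Proof.
split; first by apply/asboolP; exists 0; rewrite !linear0.
move=> a u v /asboolP[w hw] /asboolP[w' hw']; apply/asboolP.
by exists (a *: w + w'); rewrite koszul_diff_is_linear hw hw'.
Qed.

Fact koszul_boundary_closedS i : GRing.subsemimod_closed (@koszul_boundary i).
Proof. exact: GRing.submod_closed_semi (@koszul_boundary_closed i). Qed.

HB.instance Definition _ i :=
  GRing.isSubmodClosed.Build R (koszul_cycles i) (@koszul_boundary i)
    (@koszul_boundary_closedS i).

Definition koszul_boundaries (i : nat) : submodClosed (koszul_cycles i) :=
  GRing.SubmodClosed.clone R (koszul_cycles i) (@koszul_boundary i) _.

Definition koszul_homology (i : nat) : lmodType R :=
  modquot (koszul_boundaries i).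

Definition koszul_class (i : nat) (z : koszul_cycles i) : koszul_homology i :=
  modquot_pi (koszul_boundaries i) z.

(* K_i is a direct sum of copies of M(-i), and M(-i)_n = M_(n-i). *)
Definition koszul_grades (gr : grades M) (i : nat) : grades (koszul i) :=
  fun n x => forall S, gr (n - i%:Z) (x S).

Definition koszul_homology_grades (gr : grades M) (i : nat) :
    grades (koszul_homology i) :=
  fun n h => exists z : koszul_cycles i,
    koszul_grades gr n (val z) /\ h = koszul_class z.

End Koszul.

Arguments koszul_homology {R d} y M i.
Arguments koszul_homology_grades {R d} y {M} gr i n h.

(* Main.v *)
Require Import Defs.
From HB Require Import structures.
From mathcomp Require Import all_boot all_order all_algebra.
From mathcomp Require Import boolp freeg mpoly.

Set Implicit Arguments.
Unset Strict Implicit.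
Unset Printing Implicit Defensive.

Import GRing.Theory.
Local Open Scope ring_scope.

(** The Koszul homology of any graded module isomorphic to its own Frobenius
    pullback lives in degree 0. Iterating the isomorphism identifies M with
    F^e(M) for every e, so it is enough to show, for q = p ^ e, that the
    homology of F^e(M) lives in degrees divisible by q, and then to choose e
    with p ^ e > |r|.

    The polynomial ring is free over its subring of polynomials in the q-th
    powers of the variables, on the monomials with exponents below q. This
    gives F^e(M) = R (x) M a grading by (Z/q)^d in which X^m (x) u has weight
    m mod q, and the Koszul complex inherits it if the basis vector e_A is
    given the indicator vector of A as weight. The Koszul complex is acyclic in
    every nonzero weight: if the j-th weight is nonzero, then X_j acts
    bijectively between the two relevant weight spaces, and (X_j)^-1 e_j /\ _ is
    a contracting homotopy. A homogeneous element c X^m (x) u e_A of degree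
    r has |m| + |A| = r modulo q, so in weight zero r is divisible by q.

    Concretely, M itself carries this structure through a q-semilinear
    map sigma : M -> M, standing for u |-> 1 (x) u, which is universal among
    balanced maps (is_frob_pullback). Universality extends division by X_j on
    polynomials (partial_div) to an additive operator D on M
    (division_operator). The homotopy e_j /\ D connects the identity with
    the chain map koszul_defect (koszul_homotopyE), which is the projection on
    the elements whose j-th weight is zero (division_defect). Composing these
    projections over all j turns a cycle of degree r into a homologous one,
    which vanishes unless q divides r (koszul_cycle_degree). *)

(** * Additive maps and generation as a group *)

Lemma additive_of (U V : zmodType) (f : U -> V) :
  {morph f : x y / x - y} -> exists g : {additive U -> V}, g =1 f.
Proof.
move=> fB.
pose g : {additive U -> V} := HB.pack f (GRing.isZmodMorphism.Build U V f fB).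
by exists g.
Qed.

Section AdditiveSpan.
Variable V : zmodType.

Inductive zspan (G : V -> Prop) : V -> Prop :=
  | zspan0 : zspan G 0
  | zspanB x y of zspan G x & zspan G y : zspan G (x - y)
  | zspan_gen x of G x : zspan G x.

Lemma zspanD G x y : zspan G x -> zspan G y -> zspan G (x + y).
Proof.
move=> hx hy; rewrite -[y]opprK; apply: zspanB => //.
by rewrite -sub0r; apply: zspanB => //; exact: zspan0.
Qed.

Lemma zspan_sum (I : eqType) G (s : seq I) (F : I -> V) :
  (forall i, i \in s -> zspan G (F i)) -> zspan G (\sum_(i <- s) F i).
Proof.
move=> hF; rewrite big_seq; elim/big_ind: _ => //; first exact: zspan0.
exact: zspanD.
Qed.

End AdditiveSpan.

Section AdditiveSpanMap.
Variables (U V : zmodType) (f : U -> V).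
Hypothesis fB : {morph f : x y / x - y}.

Fact morphB0 : f 0 = 0.
Proof. by rewrite -[0 in LHS](subrr 0) fB subrr. Qed.

Lemma zspan_map G H x : (forall y, G y -> zspan H (f y)) ->
  zspan G x -> zspan H (f x).
Proof.
move=> GH; elim=> [|u v _ hu _ hv|u]; last exact: GH.
  by rewrite morphB0; exact: zspan0.
by rewrite fB; exact: zspanB.
Qed.

Lemma zspan_eq (g : U -> V) G x : {morph g : x y / x - y} ->
  (forall y, G y -> f y = g y) -> zspan G x -> f x = g x.
Proof.
move=> gB fg; elim=> [|u v _ hu _ hv|u]; last exact: fg.
  by rewrite morphB0 -[0 in RHS](subrr 0) gB subrr.
by rewrite fB gB hu hv.
Qed.

End AdditiveSpanMap.

(** * A homotopy on the Koszul complex *)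

Section KoszulHomotopy.
Variables (R : comNzRingType) (d : nat) (y : 'I_d -> R) (M : lmodType R).
Implicit Types (A : {set 'I_d}) (j l : 'I_d).

(** Extending a chain by zero to all subsets of 'I_d avoids carrying cardinality
    proofs when basis elements are added or removed. *)
Definition koszul_coef i (x : koszul d M i) A : M := oapp x 0 (insub A).

Lemma koszul_coef_val i (x : koszul d M i) S : koszul_coef x (val S) = x S.
Proof. by rewrite /koszul_coef valK. Qed.

Lemma koszul_coef_ffun i (f : {set 'I_d} -> M) A : #|A| = i ->
  koszul_coef ([ffun S : kidx d i => f (val S)] : koszul d M i) A = f A.
Proof.
move=> /eqP hA; rewrite /koszul_coef insubT /=.
by rewrite ffunE.
Qed.

Definition koszul_sign j A : R := (-1) ^+ #|[set l in A | (l < j)%N]|.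

(** Summing over the added index l rather than over the (i+1)-subsets leaves one
    term per l, since T = S :\ l determines S. *)
Lemma koszul_diffE i (x : koszul d M i.+1) (T : kidx d i) :
  koszul_diff y x T =
  \sum_(l | l \notin val T)
     koszul_sign l (l |: val T) *: (y l *: koszul_coef x (l |: val T)).
Proof.
rewrite ffunE (exchange_big_dep predT) //= [RHS]big_mkcond /=.
apply: eq_bigr => l _; case: ifPn => [lT | /negbNE lT]; last first.
  rewrite big_pred0 // => S; apply/negbTE/negP => /andP[_ /eqP E].
  by move: lT; rewrite E !inE eqxx.
have hS : #|l |: val T| == i.+1 by rewrite cardsU1 lT (eqP (valP T)).
rewrite (big_pred1 (Sub (l |: val T) hS)) => [|S /=]; last first.
  apply/andP/eqP => [[lS /eqP E] | ->].
    by apply: val_inj; rewrite /= E setD1K.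
  by rewrite /= setU11 setU1K.
by rewrite scalerA -koszul_coef_val.
Qed.

(** Inserting l and then deleting j differs from deleting j and then inserting
    l by one sign, because exactly one of j < l and l < j holds. This
    is what makes the off-diagonal terms of the homotopy identity cancel. *)
Lemma koszul_signC j l A : j != l -> j \notin A -> l \notin A ->
  koszul_sign l (l |: (j |: A)) * koszul_sign j (l |: (j |: A)) =
  - (koszul_sign j (j |: A) * koszul_sign l (l |: A)).
Proof.
move=> jl jA lA.
have cnt a b (B : {set 'I_d}) : b \notin B ->
  koszul_sign a (b |: B) = (-1) ^+ (b < a)%N * koszul_sign a B.
  move=> bB; rewrite /koszul_sign -exprD; congr (_ ^+ _).
  case: ltnP => ba.
    rewrite add1n -[RHS](_ : #|b |: [set m in B | (m < a)%N]| = _).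
      by congr #|pred_of_set _|; apply/setP=> m; rewrite !inE; case: eqVneq => [->|].
    by rewrite cardsU1 inE (negbTE bB).
  rewrite add0n; congr #|pred_of_set _|; apply/setP=> m; rewrite !inE.
  by case: eqVneq => [->|//]; rewrite (negbTE bB) ltnNge ba.
have ljA : l \notin j |: A by rewrite !inE negb_or eq_sym jl.
rewrite !cnt // !ltnn !mul1r mulrACA mulrA.
have -> : ((-1 : R) ^+ (j < l)%N * (-1) ^+ (l < j)%N) = -1.
  by case: ltngtP jl => // [_|_|/val_inj ->]; rewrite ?mulr1 ?mul1r ?expr1 ?eqxx.
by rewrite mulN1r [in LHS]mulrC mulrN.
Qed.

Lemma koszul_sign_sq j A : koszul_sign j A * koszul_sign j A = 1.
Proof. by rewrite /koszul_sign -expr2 sqrr_sign. Qed.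

Variables (j : 'I_d) (D : {additive M -> M}).
Hypothesis D_comm : forall l x, l != j -> D (y l *: x) = y l *: D x.

(** The coefficient at e_A of 1 - (dh + hd), for the homotopy h = e_j /\ D. The
    off-diagonal terms of dh and hd cancel, and a diagonal one comes from hd
    when j is in A, from dh when it is not. *)
Definition homotopy_defect A (x : M) : M :=
  if j \in A then x - D (y j *: x) else x - y j *: D x.

Definition koszul_defect i (z : koszul d M i) : koszul d M i :=
  [ffun S => homotopy_defect (val S) (z S)].

Definition koszul_homotopy i (z : koszul d M i) : koszul d M i.+1 :=
  [ffun S : kidx d i.+1 => if j \in val S then
     koszul_sign j (val S) *: D (koszul_coef z (val S :\ j)) else 0].

Lemma homotopy_defectB A : {morph homotopy_defect A : u v / u - v}.
Proof.
move=> u v; rewrite /homotopy_defect; case: ifP => _.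
  by rewrite scalerBr raddfB /= !opprB addrACA [RHS]addrACA; congr (_ + _); rewrite addrC.
by rewrite raddfB /= scalerBr !opprB addrACA [RHS]addrACA; congr (_ + _); rewrite addrC.
Qed.

(** The two branches of homotopy_defect are exchanged by multiplication by y_j:
    y_j (1 - D y_j) = (1 - y_j D) y_j. *)
Lemma homotopy_defect_comm l A x : l \notin A ->
  y l *: homotopy_defect (l |: A) x = homotopy_defect A (y l *: x).
Proof.
move=> lA; rewrite /homotopy_defect !inE eq_sym; case: (eqVneq l j) => [E|lj] /=.
  by rewrite -E (negbTE lA) scalerBr.
have yC u : y j *: (y l *: u) = y l *: (y j *: u) by rewrite !scalerA mulrC.
by case: ifP => _; rewrite scalerBr ?yC (D_comm _ lj) ?yC.
Qed.

(** The defect is a chain map: it acts coefficientwise, with the same signs on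
    both sides, so homotopy_defect_comm gives the commutation with d. *)
Lemma koszul_defect_cycle i (z : koszul d M i) :
  koszul_cycle y z -> koszul_cycle y (koszul_defect z).
Proof.
case: i z => [//|i] z /eqP dz; apply/eqP/ffunP => T.
have [G GE] := additive_of (@homotopy_defectB (val T)).
rewrite koszul_diffE ffunE.
transitivity (G (koszul_diff y z T)); last by rewrite dz ffunE raddf0.
rewrite koszul_diffE raddf_sum; apply: eq_bigr => l lT /=.
rewrite [RHS]raddfZsign; congr (_ *: _); rewrite GE -homotopy_defect_comm //.
congr (_ *: _); rewrite /koszul_coef /koszul_defect.
by rewrite insubT ?cardsU1 ?lT ?(eqP (valP T)) //= => h; rewrite ffunE.
Qed.

(** On a cycle hd vanishes, so dh = 1 - defect. At T containing j this uses the
    cycle condition at T :\ j to trade D (y_j z_T) for the other terms. *)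
Lemma koszul_homotopyE i (z : koszul d M i) : koszul_cycle y z ->
  koszul_diff y (koszul_homotopy z) = z - koszul_defect z.
Proof.
move=> cz; apply/ffunP => T; rewrite koszul_diffE !ffunE /homotopy_defect.
have hom l : l \notin val T -> koszul_coef (koszul_homotopy z) (l |: val T) =
    if j \in l |: val T then
     koszul_sign j (l |: val T) *: D (koszul_coef z ((l |: val T) :\ j)) else 0.
  move=> lT; rewrite (koszul_coef_ffun (fun A => if j \in A then
     koszul_sign j A *: D (koszul_coef z (A :\ j)) else 0)) //.
  by rewrite cardsU1 lT (eqP (valP T)).
(* When j is outside T, only the summand l = j meets the support of h z. *)
case: ifPn => jT; last first.
  rewrite opprB addrC subrK (bigD1 j) //= hom // setU11 setU1K // koszul_coef_val.
  rewrite [y j *: (_ *: _)]scalerA [y j * _]mulrC -scalerA scalerA koszul_sign_sq scale1r.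
  rewrite big1 => [|l /andP[lT lj]]; last first.
    by rewrite hom // !inE eq_sym (negbTE lj) (negbTE jT) !scaler0.
  by rewrite addr0.
rewrite opprB addrC subrK.
(* A set T containing j is nonempty, so the degree is positive. *)
case: i z cz T hom jT => [|i] z cz T hom jT.
  by move: (valP T) jT; rewrite cards_eq0 => /eqP ->; rewrite inE.
have hT' : #|val T :\ j| == i.
  by move: (valP T); rewrite (cardsD1 j) jT add1n eqSS.
pose T' : kidx d i := Sub (val T :\ j) hT'.
have := congr1 D (congr1 (fun u : koszul d M i => u T') (eqP cz)).
rewrite [in RHS]ffunE [RHS]raddf0 koszul_diffE /= (bigD1 j) /=; last by rewrite !inE eqxx.
rewrite setD1K // koszul_coef_val raddfD raddfZsign => /eqP.
rewrite addrC addr_eq0 => /eqP E.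
rewrite -[RHS]scale1r -(koszul_sign_sq j (val T)) -scalerA.
rewrite -[koszul_sign j _ *: D _]opprK -E raddf_sum -sumrN scaler_sumr.
apply: eq_big => [l|l lT].
  by rewrite !inE negb_and negbK; case: eqVneq => [->|]; rewrite ?jT ?andbT.
have lj : l != j by apply: contraNneq lT => ->.
rewrite hom // !inE jT orbT.
have -> : (l |: val T) :\ j = l |: (val T :\ j).
  by apply/setP=> m; rewrite !inE; case: (eqVneq m l) => [->|]; rewrite ?lj.
rewrite [in RHS]raddfZsign D_comm //.
set u := D _; rewrite [in RHS]scalerN scalerA.
have -> : koszul_sign j (val T) *: (koszul_sign l (l |: val T :\ j) *: (y l *: u)) =
  (koszul_sign j (j |: (val T :\ j)) * koszul_sign l (l |: val T :\ j)) *: (y l *: u).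
  by rewrite setD1K // scalerA.
rewrite -scaleNr -koszul_signC; last 3 first.
- by rewrite eq_sym.
- by rewrite !inE eqxx.
- by rewrite !inE negb_and lT orbT.
by rewrite setD1K // !scalerA -!mulrA; congr (_ *: _); congr (_ * _); rewrite mulrC.
Qed.

End KoszulHomotopy.

(** * Modules pulled back along a power of Frobenius *)

Section FrobeniusPullback.
Variable R : comNzRingType.

(** M is R (x) N for the q-th power map of R, with a *: sigma u standing for
    a (x) u. A characterization by generators and a universal property composes
    more easily than isomorphisms of iterated tensor products. *)
Record is_frob_pullback (q : nat) (N M : lmodType R) (sigma : N -> M) : Prop :=
  IsFrobPullback {
  pullbackB : {morph sigma : u v / u - v};
  pullbackZ : forall r u, sigma (r *: u) = r ^+ q *: sigma u;
  pullback_span : forall x,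
    zspan (fun y => exists a u, y = a *: sigma u) x;
  pullback_lift : forall (V : zmodType) (b : R -> N -> V), frob_balanced q b ->
    exists L : {additive M -> V}, forall a u, L (a *: sigma u) = b a u
}.

Lemma frob_pullback_id (M : lmodType R) : is_frob_pullback 1 (@id M).
Proof.
split=> //.
- by move=> x; apply: zspan_gen; exists 1, x; rewrite scale1r.
- move=> V b [bDl bDr bA].
  have bB : {morph b 1 : u v / u - v}.
    move=> u v; apply: (addIr (b 1 v)).
    by rewrite -bDr !subrK.
  have [L LE] := additive_of bB; exists L => a u.
  by rewrite LE -bA mulr1.
Qed.

Lemma frob_pullback_iso p (M : lmodType R) (theta : {linear M -> frob p M}) :
  bijective theta ->
  exists sigma : M -> M, is_frob_pullback p sigma /\
    forall a u, theta (a *: sigma u) = frob_tens a u.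
Proof.
case=> thetai thetaK thetaiK.
have thI : injective theta := can_inj thetaK.
have thE a u : theta (a *: thetai (frob_tens 1 u)) = frob_tens a u.
  by rewrite linearZ /= thetaiK frob_scaleE mulr1.
exists (fun u => thetai (frob_tens 1 u)); split=> //; split.
- move=> u v; apply: thI; rewrite raddfB /= !thetaiK.
  by apply: (addIr (frob_tens 1 v)); rewrite -frob_tensDr !subrK.
- move=> r u; apply: thI.
  by rewrite thetaiK thE -frob_tensA mulr1.
- move=> x; rewrite -[x]thetaK; elim/frob_ind: (theta x) => [|u v hu hv|a m].
  + rewrite (_ : thetai 0 = 0); first exact: zspan0.
    by apply: thI; rewrite thetaiK raddf0.
  + rewrite (_ : thetai _ = thetai u - thetai v); first exact: zspanB.
    by apply: thI; rewrite raddfB /= !thetaiK.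
  + by apply: zspan_gen; exists a, m; rewrite -thE thetaK.
- move=> V b bb; have [LB LE] := frob_liftE bb.
  have [|L LL] := @additive_of _ _ (frob_lift b \o theta).
    by move=> x y /=; rewrite raddfB LB.
  by exists L => a u; rewrite LL /= thE LE.
Qed.

(** A (q * p)-balanced b factors in two steps. For fixed a the map
    (c, u) |-> b (a * c ^+ p) u is q-balanced, hence induces K a on N, and
    (a, n) |-> K a n is then p-balanced. Additivity of the p-th power is what
    makes the first map additive in c. *)
Lemma frob_pullback_comp p q (L N M : lmodType R) (tau : L -> N) (sigma : N -> M) :
  (forall a b : R, (a + b) ^+ p = a ^+ p + b ^+ p) ->
  is_frob_pullback q tau -> is_frob_pullback p sigma ->
  is_frob_pullback (q * p) (sigma \o tau).
Proof.
move=> expD [tB tZ tS tL] [sB sZ sS sL]; split.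
- by move=> u v /=; rewrite tB sB.
- by move=> r u /=; rewrite tZ sZ -exprM.
- move=> x; apply: (zspan_map (f := id)) (sS x) => // _ [a [u ->]].
  have fB : {morph (fun m => a *: sigma m) : v w / v - w}.
    by move=> v w; rewrite sB scalerBr.
  apply: (zspan_map fB) (tS u) => _ [b [v ->]].
  by apply: zspan_gen; exists (a * b ^+ p), v; rewrite /= sZ scalerA.
- move=> V b [bDl bDr bA].
  have hK a : exists K : {additive N -> V},
      forall c u, K (c *: tau u) = b (a * c ^+ p) u.
    apply: tL; split=> [u c c'|c u u'|c r u].
    - by rewrite expD mulrDr bDl.
    - exact: bDr.
    - by rewrite exprMn -exprM mulrCA bA.
  have [K KE] := choice hK.
  have Kuniq (f g : N -> V) : {morph f : u v / u - v} -> {morph g : u v / u - v} ->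
      (forall c u, f (c *: tau u) = g (c *: tau u)) -> f =1 g.
    by move=> fB gB fg x; apply: (zspan_eq fB gB _ (tS x)) => _ [c [u ->]].
  have [|F FE] := sL V (fun a n => K a n).
    split=> [n a a'|a n n'|a r n].
    - apply: (Kuniq (K (a + a')) (fun n => K a n + K a' n)) => [|u v|c u].
      + exact: raddfB.
      + by rewrite !raddfB opprD addrACA.
      + by rewrite !KE mulrDl bDl.
    - exact: raddfD.
    - apply: (Kuniq (K (r ^+ p * a)) (fun n => K a (r *: n))) => [|u v|c u].
      + exact: raddfB.
      + by rewrite scalerBr raddfB.
      + by rewrite scalerA !KE exprMn mulrCA mulrA.
  exists F => a u /=.
  by rewrite FE -[tau u]scale1r KE expr1n mulr1.
Qed.

End FrobeniusPullback.

(** * Partial division by a variable *)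

Section MonomialExtension.
Variables (k : fieldType) (d : nat).
Local Notation R := {mpoly k[d]}.

Lemma mpoly_homog_span e (a : R) : a \is e.-homog ->
  zspan (fun b => exists c m, b = c *: 'X_[m] /\ mdeg m = e) a.
Proof.
move=> /dhomogP ha; rewrite [a]mpolyE; apply: zspan_sum => m hm.
by apply: zspan_gen; exists a@_m, m; split=> //; exact: ha.
Qed.

Lemma mpoly_span (a : R) : zspan (fun b => exists c m, b = c *: 'X_[m]) a.
Proof.
rewrite [a]mpolyE; apply: zspan_sum => m hm.
by apply: zspan_gen; exists a@_m, m.
Qed.

Definition mpoly_extend (V : lmodType k) (g : 'X_{1..d} -> V) (a : R) : V :=
  fglift g (mpoly_val a).

Lemma mpoly_extendB (V : lmodType k) (g : 'X_{1..d} -> V) :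
  {morph mpoly_extend g : a b / a - b}.
Proof. by move=> a b; rewrite /mpoly_extend -lift_is_additive. Qed.

Lemma mpoly_extendX (V : lmodType k) (g : 'X_{1..d} -> V) c m :
  mpoly_extend g (c *: 'X_[m]) = c *: g m.
Proof.
rewrite /mpoly_extend -(liftU g).
have -> : mpoly_val (c *: 'X_[m] : R) = c *: << m >> by rewrite unlock.
by congr fglift; apply/eqP/freeg_eqP => x; rewrite coeffZ !coeffU mul1r.
Qed.

Section Division.
Variables (q : nat) (j : 'I_d).

(** Division by X_j inside the blocks of exponents of length q, extended by zero
    at the bottom of each block: multiplication by X_j is then inverted
    wherever this is possible linearly over the polynomials in the q-th powers
    of the variables. *)
Definition mnm_divided (m : 'X_{1..d}) : R :=
  if (q %| m j)%N then 0 else 'X_[m - U_(j)].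

Definition partial_div : R -> R := mpoly_extend mnm_divided.

Lemma partial_divB : {morph partial_div : a b / a - b}.
Proof. exact: mpoly_extendB. Qed.

Lemma partial_divD : {morph partial_div : a b / a + b}.
Proof.
by move=> a b; apply: (addIr (- partial_div b)); rewrite -partial_divB !addrK.
Qed.

Lemma partial_divX c m : partial_div (c *: 'X_[m]) = c *: mnm_divided m.
Proof. exact: mpoly_extendX. Qed.

(** The point of testing divisibility of the exponent instead of positivity:
    division commutes with monomials of j-th exponent divisible by q, which
    covers both the other variables and all q-th powers. *)
Lemma mnm_dividedM (m n : 'X_{1..d}) : (q %| n j)%N ->
  mnm_divided (n + m) = 'X_[n] * mnm_divided m.
Proof.
move=> qn; rewrite /mnm_divided mnmDE dvdn_addr //.
case: ifPn => [|qm]; first by rewrite mulr0.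
rewrite -mpolyXD addmBA // lep1mP.
by apply: contraNneq qm => ->.
Qed.

Lemma partial_div_mulX (n : 'X_{1..d}) a : (q %| n j)%N ->
  partial_div ('X_[n] * a) = 'X_[n] * partial_div a.
Proof.
move=> qn; apply: (zspan_eq (f := fun a => partial_div ('X_[n] * a))
  (g := fun a => 'X_[n] * partial_div a) _ _ _ (mpoly_span a)).
- by move=> u v; rewrite mulrBr; exact: partial_divB.
- by move=> u v; rewrite partial_divB mulrBr.
- by move=> _ [c [m ->]];
  rewrite -scalerAr -mpolyXD !partial_divX mnm_dividedM // scalerAr.
Qed.

Lemma partial_divZ c a : partial_div (c *: a) = c *: partial_div a.
Proof.
apply: (zspan_eq (f := fun a => partial_div (c *: a))
  (g := fun a => c *: partial_div a) _ _ _ (mpoly_span a)).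
- by move=> u v; rewrite scalerBr; exact: partial_divB.
- by move=> u v; rewrite partial_divB scalerBr.
- by move=> _ [b [m ->]]; rewrite scalerA !partial_divX scalerA.
Qed.

Hypothesis expD : forall a b : R, (a + b) ^+ q = a ^+ q + b ^+ q.

Lemma partial_div_mul_exp r a : partial_div (r ^+ q * a) = r ^+ q * partial_div a.
Proof.
have expB : {morph (fun r : R => r ^+ q) : u v / u - v}.
  by move=> u v; apply: (addIr (v ^+ q)); rewrite -expD !subrK.
apply: (zspan_eq (f := fun r => partial_div (r ^+ q * a))
  (g := fun r => r ^+ q * partial_div a) _ _ _ (mpoly_span r)).
- by move=> u v; rewrite expB mulrBl; exact: partial_divB.
- by move=> u v; rewrite expB mulrBl.
- move=> _ [c [m ->]]; rewrite exprZn mpolyXn -!scalerAl partial_divZ.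
  by rewrite partial_div_mulX // mulmnE dvdn_mull.
Qed.

End Division.

End MonomialExtension.

(** * Weights on a graded module isomorphic to its Frobenius pullback *)

Section GradedPullback.
Variables (k : fieldType) (p d : nat) (p_char : p \in [pchar k]).
Local Notation R := {mpoly k[d]}.

Lemma mpoly_expD e (a b : R) : (a + b) ^+ (p ^ e) = a ^+ (p ^ e) + b ^+ (p ^ e).
Proof.
have pR : p \in [pchar R].
  exact: (@rmorph_pchar k R (@mpolyC d k) p p_char).
apply: exprDn_pchar; rewrite pnatX; apply/orP; left.
by rewrite pnatE // (pcharf_prime pR).
Qed.

Variables (M : lmodType R) (gr : grades M).
Local Notation vars := (fun j : 'I_d => 'X_j : R).

Definition homog_generator (q : nat) (sigma : M -> M) (n : int) (y : M) : Prop :=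
  exists (e : nat) (b : int) (a : R) (u : M),
  [/\ y = a *: sigma u, a \is e.-homog, gr b u & e%:Z + q%:Z * b = n].

(** The isomorphism theta preserves degrees, so homogeneous elements of M are sums
    of a *: sigma u with a and u homogeneous. On iteration degrees compose as
    e + p (e' + q b) = (e + e' p) + (p q) b. *)
Lemma graded_pullback_iter (theta : {linear M -> frob p M}) e :
  is_graded_FR_module gr theta ->
  exists sigma : M -> M, is_frob_pullback (p ^ e) sigma /\
    forall n x, gr n x -> zspan (homog_generator (p ^ e) sigma n) x.
Proof.
case=> _ thbij thdeg; have [sigma [sP thE]] := frob_pullback_iso thbij.
have thI := bij_inj thbij.
have sG n x : gr n x -> zspan (homog_generator p sigma n) x.
  move=> /thdeg[s [hs sE]].
  have -> : x = \sum_(u <- s) u.1 *: sigma u.2.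
    by apply: thI; rewrite sE raddf_sum; apply: eq_bigr => u _ /=; rewrite thE.
  apply: zspan_sum => u /hs[c [b [h1 h2 h3]]]; apply: zspan_gen.
  by exists c, b, u.1, u.2.
elim: e => [|e [tau [tP tG]]].
  exists id; split; first exact: frob_pullback_id.
  move=> n x gx; apply: zspan_gen; exists 0%N, n, 1, x.
  by rewrite scale1r dhomog1 expn0 mul1r add0r.
exists (sigma \o tau); split.
  by rewrite expnSr; apply: frob_pullback_comp tP sP; move=> a b; exact: (mpoly_expD 1).
move=> n x /sG; apply: (zspan_map (f := id)) => // _ [c [b [a [u [-> ha hu hn]]]]].
have fB : {morph (fun m => a *: sigma m) : v w / v - w}.
  by move=> v w; rewrite (pullbackB sP) scalerBr.
apply: (zspan_map fB) (tG _ _ hu) => _ [c' [b' [a' [u' [-> ha' hu' hb]]]]].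
apply: zspan_gen; exists (c + c' * p)%N, b', (a * a' ^+ p), u'.
split=> //.
- by rewrite (pullbackZ sP) scalerA.
- by apply: dhomogM => //; exact: dhomogMn.
- by rewrite -hn -hb PoszD expnSr !PoszM mulrDr addrA -!mulrA mulrC [X in _ + X]mulrCA.
Qed.

Lemma monomial_generators q (sigma : M -> M) n x :
  zspan (homog_generator q sigma n) x ->
  zspan (fun y => exists c m b u,
    y = (c *: 'X_[m] : R) *: sigma u /\ (mdeg m)%:Z + q%:Z * b = n) x.
Proof.
apply: (zspan_map (f := id)) => // _ [e [b [a [u [-> ha hu hn]]]]].
have fB : {morph (fun a : R => a *: sigma u) : v w / v - w}.
  by move=> v w; rewrite scalerBl.
apply: (zspan_map fB) (mpoly_homog_span ha) => _ [c [m [-> hm]]].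
by apply: zspan_gen; exists c, m, b, u; rewrite hm.
Qed.

Section Defect.
Variables (q : nat) (sigma : M -> M).
Hypothesis sigmaP : is_frob_pullback q sigma.
Hypothesis expD : forall a b : R, (a + b) ^+ q = a ^+ q + b ^+ q.

Lemma division_operator j : exists D : {additive M -> M},
  forall a u, D (a *: sigma u) = partial_div q j a *: sigma u.
Proof.
have sB := pullbackB sigmaP.
have sD u v : sigma (u + v) = sigma u + sigma v.
  by apply: (addIr (- sigma v)); rewrite -sB !addrK.
apply: (pullback_lift sigmaP); split=> [u a a'|a u u'|a r u].
- by rewrite partial_divD scalerDl.
- by rewrite sD scalerDr.
- by rewrite partial_div_mul_exp // (pullbackZ sigmaP) scalerA mulrC.
Qed.

Variables (j : 'I_d) (D : {additive M -> M}).
Hypothesis DE : forall a u, D (a *: sigma u) = partial_div q j a *: sigma u.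

Lemma division_comm l x : l != j -> D (('X_l : R) *: x) = ('X_l : R) *: D x.
Proof.
move=> lj; apply: (zspan_eq (f := fun x => D (('X_l : R) *: x))
  (g := fun x => ('X_l : R) *: D x) _ _ _ (pullback_span sigmaP x)).
- by move=> u v; rewrite scalerBr raddfB.
- by move=> u v; rewrite raddfB scalerBr.
- move=> _ [a [u ->]]; rewrite scalerA !DE partial_div_mulX ?scalerA //.
  by rewrite mnm1E (negbTE lj).
Qed.

(** On a generator of weight m, the defect at e_A is the projection on the part
    whose j-th weight, counting the contribution of e_A, is zero modulo q. *)
Lemma division_defect A c m u :
  let x := (c *: 'X_[m] : R) *: sigma u in
  homotopy_defect vars j D A x =
  if (q %| m j + (j \in A))%N then x else 0.
Proof.
rewrite /= /homotopy_defect; case: (j \in A).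
  rewrite scalerA -scalerAr -mpolyXD DE partial_divX /mnm_divided mnmDE mnm1E eqxx.
  rewrite addnC; case: ifP => _; first by rewrite scaler0 scale0r subr0.
  by rewrite addmC addmK subrr.
rewrite addn0 DE partial_divX /mnm_divided.
case: ifPn => qm; first by rewrite scaler0 scale0r scaler0 subr0.
rewrite scalerA -scalerAr -mpolyXD addmBA ?lep1mP; last first.
  by apply: contraNneq qm => ->.
by rewrite addmC addmK subrr.
Qed.

End Defect.

(** Applying the defects of all variables in turn replaces z by a homologous
    cycle supported in weight zero, where the degree would be a multiple
    of q. *)
Lemma koszul_cycle_degree q (sigma : M -> M) i (r : int)
    (z : koszul d M i) :
  is_frob_pullback q sigma ->
  (forall a b : R, (a + b) ^+ q = a ^+ q + b ^+ q) ->
  (forall n x, gr n x -> zspan (homog_generator q sigma n) x) ->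
  ~ (exists b, r = q%:Z * b) ->
  koszul_grades gr r z -> koszul_cycle vars z ->
  exists w, koszul_diff vars w = z.
Proof.
move=> sP expD sG nqr gz cz.
have [D DE] := choice (division_operator sP expD).
pose Q s := foldr (fun j z => koszul_defect vars j (D j) z) z s.
have QP s : koszul_cycle vars (Q s) /\
    exists w, koszul_diff vars w = z - Q s.
  elim: s => [|j s [IHc [w IHw]]]; first by split=> //; exists 0; rewrite raddf0 subrr.
  have comm := division_comm sP (DE j).
  split; first exact: koszul_defect_cycle.
  exists (w + koszul_homotopy j (D j) (Q s)).
  by rewrite raddfD /= IHw koszul_homotopyE // addrA subrK.
have [_ [w wE]] := QP (enum 'I_d); exists w; rewrite wE.
suff -> : Q (enum 'I_d) = 0 by rewrite subr0.
apply/ffunP=> T; rewrite [RHS]ffunE.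
pose F s := foldr (fun j x => homotopy_defect vars j (D j) (val T) x) ^~ s.
have FE s : Q s T = F s (z T).
  by elim: s => [//|j s IH]; rewrite /= ffunE IH.
have FB s : {morph F s : u v / u - v}.
  by move=> u v; elim: s => [//|j s IH] /=; rewrite IH homotopy_defectB.
rewrite FE; apply: (zspan_eq (FB _) (g := fun=> 0) _ _
  (monomial_generators (sG _ _ (gz T)))).
  by move=> u v; rewrite subr0.
move=> _ [c [m [b [u [-> hm]]]]].
have FX s : F s ((c *: 'X_[m] : R) *: sigma u) =
    if all (fun j => q %| m j + (j \in val T))%N s
    then (c *: 'X_[m] : R) *: sigma u else 0.
  elim: s => [//|j s IH] /=; rewrite IH; case: (all _ s); last first.
    by rewrite andbF (morphB0 (homotopy_defectB _ _ _ _)).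
  by rewrite (division_defect (DE j)) andbT.
rewrite FX; case: ifP => // /allP qdvd; case: nqr.
(* The total weight of X^m e_T is |m| + i, since T has i elements. *)
have : (q %| mdeg m + i)%N.
  rewrite -(eqP (valP T)) -sum1_card mdegE [X in (_ + X)%N]big_mkcond -big_split /=.
  by apply: dvdn_sum => j _; have := qdvd j (mem_enum _ _); case: (j \in val T).
case/dvdnP=> a ha; exists (a%:Z + b).
by rewrite mulrDr -PoszM mulnC -ha PoszD addrAC hm subrK.
Qed.

End GradedPullback.

(** * Concentration in degree zero *)

Theorem corollary1p3 (k : fieldType) (p d : nat)
    (k_infinite : ~ exists s : seq k, forall x : k, x \in s)
    (k_char : p \in [pchar k])
    (M : lmodType {mpoly k[d]}) (gr : grades M) (theta : {linear M -> frob p M})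
    (M_FR_finite : is_graded_FR_finite gr theta)
    (i : nat) (i_le_d : (i <= d)%N) (r : int) (r_neq0 : r != 0)
    (h : koszul_homology (fun j : 'I_d => 'X_j : {mpoly k[d]}) M i)
    (h_deg_r : koszul_homology_grades (fun j : 'I_d => 'X_j) gr i r h) :
  h = 0.
Proof.
have [FR _] := M_FR_finite; have [z [gz ->]] := h_deg_r.
(* Any exponent e with p ^ e > |r| would do; e = |r| is one since n < p ^ n. *)
have [sigma [sP sG]] := graded_pullback_iter k_char `|r|%N FR.
rewrite -(raddf0 (modquot_pi (koszul_boundaries (fun j : 'I_d => 'X_j : {mpoly k[d]}) M i))).
apply/modquot_pi_eq; rewrite subr0; apply/asboolP.
apply: (koszul_cycle_degree sP _ sG _ gz (valP z)).
  exact: (mpoly_expD k_char).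
case=> b rE; have rN : `|r|%N = (p ^ `|r| * `|b|)%N by rewrite {1}rE abszM.
have := ltn_expl `|r|%N (prime_gt1 (pcharf_prime k_char)).
rewrite ltnNge {2}rN leq_pmulr // absz_gt0.
by apply: contraNneq r_neq0 => b0; rewrite rE b0 mulr0.
Qed.
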